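(* Let $I=\langle m_1,\dots,m_r\rangle\subseteq \mathbf{k}[x_1,\dots,x_d]$ be a monomial ideal with minimal monomial generators $m_1,\dots,m_r$. For every $k$ with $1\le k\le r$, the complex $\mathbf{I}_k$ (defined in the context) is a free resolution of the $k$-fold lcm-ideal $I_k$. Moreover, the Betti numbers of the $k$-out-of-$r$ ideal $I_{k,r}\subseteq\mathbf{k}[x_1,\dots,x_r]$ are an upper bound for the Betti numbers of $I_k$, that is, $\beta_i(I_k)\le\beta_i(I_{k,r})$ for all $i$.
   Context: $\mathbf{k}$ is a field and $R=\mathbf{k}[x_1,\dots,x_d]$. For $A\subseteq\{1,\dots,r\}$ put $m_A=\operatorname{lcm}(m_i : i\in A)$. The $k$-fold lcm-ideal of $I$ is $I_k=\langle m_\sigma : \sigma\subseteq\{1,\dots,r\},\ |\sigma|=k\rangle\subseteq R$. The $k$-out-of-$r$ ideal $I_{k,r}\subseteq \mathbf{k}[x_1,\dots,x_r]$ is the ideal generated by all products of $k$ different variables. For a monomial ideal $J$, $\beta_i(J)$ denotes its $i$-th total Betti number, i.e. the rank of the module in homological degree $i$ in the minimal graded free resolution of $J$ over its polynomial ring (with $\beta_0$ the number of minimal generators). The complex $\mathbf{I}_k$: $0\to F_{r-k}\to\cdots\to F_1\to F_0\to I_k\to 0$ is the following. $F_i$ is the free $R$-module with basis the symbols $[\sigma,\tau]$ where $\sigma,\tau\subseteq\{1,\dots,r\}$, $\sigma\cap\tau=\emptyset$, $|\sigma|=k$, $|\tau|=i$ and $\max(\sigma)>\max(\tau)$; the multidegree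 of $[\sigma,\tau]$ is that of $m_{\sigma\cup\tau}$. By convention the maximum of the empty set is smaller than every element of $\{1,\dots,r\}$. The augmentation $F_0\to I_k$ sends $[\sigma,\emptyset]$ to $m_\sigma$. For a set $A$, $A-j$ and $A+j$ denote removing, respectively adding, the element $j$. For $j\in\tau$, $\operatorname{sgn}(j,\tau)$ denotes the number of elements of $\tau$ that are larger than $j$. For $\tau\neq\emptyset$ the differential is $$\partial([\sigma,\tau])=\sum_{j\in\tau}(-1)^{\operatorname{sgn}(j,\tau)}\Big(-\frac{m_{\sigma\cup\tau}}{m_{\sigma\cup\tau-j}}[\sigma,\tau-j]+\frac{m_{\sigma\cup\tau}}{m_{\sigma\cup\tau-\max(\sigma)}}[\sigma-\max(\sigma)+j,\tau-j]\Big)$$ if $\max(\tau)<\max(\sigma-\max(\sigma))$, and $$\partial([\sigma,\tau])=\sum_{j\in\tau}(-1)^{\operatorname{sgn}(j,\tau)}\Big(-\frac{m_{\sigma\cup\tau}}{m_{\sigma\cup\tau-j}}[\sigma,\tau-j]\Big)+\frac{m_{\sigma\cup\tau}}{m_{\sigma\cup\tau-\max(\sigma)}}[\sigma-\max(\sigma)+\max(\tau),\tau-\max(\tau)]$$ if $\max(\tau)>\max(\sigma-\max(\sigma))$. *)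

(* Defs.v *)
From HB Require Import structures.
From mathcomp Require Import all_boot all_order all_algebra.
From mathcomp Require Import mpoly.
From Stdlib Require Import ClassicalEpsilon.

Set Implicit Arguments.
Unset Strict Implicit.
Unset Printing Implicit Defensive.

Import GRing.Theory.
Local Open Scope ring_scope.

(* Ideals are represented as predicates on the ring. *)
Definition gen_ideal (R : comNzRingType) (T : finType) (P : pred T)
    (g : T -> R) : R -> Prop :=
  fun f => exists c : T -> R, f = \sum_(t | P t) c t * g t.

Definition free_module (R : comNzRingType) (T : finType) : lmodType R :=
  {ffun T -> R^o}.

(* A complex ... -> F_1 -> F_0 -> R of free modules of finite rank, where F_i
   is free on cbasis i; the maps are given by their values on the basis.
   The complex is indexed by all of nat: one of finite length has empty bases
   from some point on. *)
Record free_complex (R : comNzRingType) := FreeComplex {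
  cbasis : nat -> finType;
  cdiff_basis : forall i : nat, cbasis i.+1 -> free_module R (cbasis i);
  caug_basis : cbasis 0 -> R }.

Definition cdiff (R : comNzRingType) (C : free_complex R) (i : nat)
    (v : free_module R (cbasis C i.+1)) : free_module R (cbasis C i) :=
  \sum_b v b *: cdiff_basis b.

Definition caug (R : comNzRingType) (C : free_complex R)
    (v : free_module R (cbasis C 0)) : R :=
  \sum_b v b * caug_basis b.

Definition free_resolution (R : comNzRingType) (C : free_complex R)
    (J : R -> Prop) : Prop :=
  [/\ forall f, J f <-> exists v, caug (C := C) v = f,
      forall v, caug (C := C) v = 0 <-> exists w, cdiff (i := 0) w = v
    & forall (i : nat) (v : free_module R (cbasis C i.+1)),
        cdiff v = 0 <-> exists w, cdiff (i := i.+1) w = v].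

Section PolynomialRing.

Variables (K : fieldType) (n : nat).
Implicit Types (C : free_complex {mpoly K[n]}) (J : {mpoly K[n]} -> Prop).

(* [deg] assigns a multidegree to every basis element; all maps preserve it. *)
Definition multigraded C (deg : forall i, cbasis C i -> 'X_{1..n}) : Prop :=
  (forall (b : cbasis C 0) (u : 'X_{1..n}),
      u \in msupp (caug_basis b) -> deg 0%N b = u) /\
  (forall i (b : cbasis C i.+1) (b' : cbasis C i) (u : 'X_{1..n}),
      u \in msupp (cdiff_basis b b') -> deg i.+1 b = (u + deg i b')%MM).

(* The same for the standard grading, in which every variable has degree 1. *)
Definition graded C (deg : forall i, cbasis C i -> nat) : Prop :=
  (forall (b : cbasis C 0) (u : 'X_{1..n}),
      u \in msupp (caug_basis b) -> deg 0%N b = mdeg u) /\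
  (forall i (b : cbasis C i.+1) (b' : cbasis C i) (u : 'X_{1..n}),
      u \in msupp (cdiff_basis b b') -> deg i.+1 b = (mdeg u + deg i b')%N).

(* The entries of the differentials lie in the ideal (x_1, ..., x_n). *)
Definition minimal C : Prop :=
  forall i (b : cbasis C i.+1) (b' : cbasis C i),
    (cdiff_basis b b')@_0%MM = 0.

Definition is_betti J (i b : nat) : Prop :=
  exists (C : free_complex {mpoly K[n]}) (deg : forall i, cbasis C i -> nat),
    [/\ free_resolution C J, graded deg, minimal C & #|cbasis C i| = b].

(* Minimal graded free resolutions of homogeneous ideals exist and are unique
   up to isomorphism; the value 0 only matters for other predicates [J]. *)
Definition betti J (i : nat) : nat :=
  match excluded_middle_informative (exists b, is_betti J i b) with
  | left e => proj1_sig (constructive_indefinite_description _ e)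
  | right _ => 0%N
  end.

End PolynomialRing.

(* The indices {1, ..., r} are represented by 'I_r, so that i : 'I_r stands for
   i.+1; with these labels max(set0) = 0 is below every index. *)
Section IndexSets.

Variable r : nat.
Implicit Types A : {set 'I_r}.

Definition setmax A : nat := \max_(i in A) i.+1.

(* A - max(A) and {max(A)}, both empty if A is. *)
Definition del_max A : {set 'I_r} := [set i in A | i.+1 != setmax A].
Definition top A : {set 'I_r} := [set i in A | i.+1 == setmax A].

Definition sgn (j : 'I_r) A : nat := #|[set l in A | (j < l)%N]|.

Definition symb_pred (k i : nat) (st : {set 'I_r} * {set 'I_r}) : bool :=
  [&& [disjoint st.1 & st.2], #|st.1| == k, #|st.2| == i
    & (setmax st.2 < setmax st.1)%N].

Definition symb (k i : nat) : finType :=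
  {st : {set 'I_r} * {set 'I_r} | symb_pred k i st}.

End IndexSets.

Section LcmIdeals.

Variables (K : fieldType) (d r : nat) (m : 'I_r -> 'X_{1..d}).

Definition minimal_generators : Prop :=
  forall i : 'I_r,
    ~ gen_ideal (fun j => j != i) (fun j => 'X_[K, m j]) 'X_[m i].

Definition mlcm_set (A : {set 'I_r}) : 'X_{1..d} :=
  \big[@mlcm d/0%MM]_(i in A) m i.

Definition lcm_ideal (k : nat) : {mpoly K[d]} -> Prop :=
  gen_ideal (fun s : {set 'I_r} => #|s| == k) (fun s => 'X_[mlcm_set s]).

(* The basis element [s, t] of F_i (and 0 if (s, t) is not a symbol, which
   does not happen for the pairs occurring in [lcm_diff]). *)
Definition symb_elt (k i : nat) (s t : {set 'I_r}) :
    free_module {mpoly K[d]} (symb r k i) :=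
  [ffun b => (val b == (s, t))%:R].

(* The monomial m_A / m_B, for B a subset of A. *)
Definition mquo (A B : {set 'I_r}) : {mpoly K[d]} :=
  'X_[mlcm_set A - mlcm_set B].

(* The case max(t) = max(s - max(s)) does not arise, since t is nonempty and
   disjoint from s. *)
Definition lcm_diff (k i : nat) (b : symb r k i.+1) :
    free_module {mpoly K[d]} (symb r k i) :=
  let s := (val b).1 in
  let t := (val b).2 in
  let u := s :|: t in
  if (setmax t < setmax (del_max s))%N then
    \sum_(j in t) (-1) ^+ sgn j t *:
      (- (mquo u (u :\ j) *: symb_elt k i s (t :\ j))
       + mquo u (u :\: top s) *: symb_elt k i (j |: del_max s) (t :\ j))
  else
    (\sum_(j in t) (-1) ^+ sgn j t *:
       (- (mquo u (u :\ j) *: symb_elt k i s (t :\ j))))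
    + mquo u (u :\: top s) *: symb_elt k i (top t :|: del_max s) (del_max t).

Definition lcm_complex (k : nat) : free_complex {mpoly K[d]} :=
  FreeComplex (@lcm_diff k)
    (fun b : symb r k 0 => 'X_[mlcm_set (val b).1]).

Definition lcm_complex_deg (k i : nat) (b : cbasis (lcm_complex k) i) :
    'X_{1..d} :=
  mlcm_set ((val b).1 :|: (val b).2).

End LcmIdeals.

Definition k_out_of_r_ideal (K : fieldType) (r k : nat) :
    {mpoly K[r]} -> Prop :=
  gen_ideal (fun s : {set 'I_r} => #|s| == k) (fun s => \prod_(i in s) 'X_i).

Arguments lcm_ideal K {d r} m k _.
Arguments lcm_complex K {d r} m k.
Arguments lcm_complex_deg K {d r} m k i b.
Arguments k_out_of_r_ideal : clear implicits.

(* Main.v *)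
(* Over every multidegree u the complex restricts to a complex of K-vector
   spaces with basis the symbols inside A = {i | m_i divides u}. It is exact:
   each [sigma] carries a simplex on the elements of A below max(sigma) and
   outside sigma, the terms [sigma, tau - j] form its augmented boundary, and
   the remaining terms strictly lower the sum of sigma, so cycles can be
   removed from the top by coning each simplex off from its largest vertex.
   The simplex is empty only if sigma is the initial segment of A.

   For I_{k,r} all entries of the same complex lie in the maximal ideal, so
   its ranks are Betti numbers. Comparing a minimal resolution with this one
   and reducing the homotopy equivalence modulo the maximal ideal bounds the
   ranks of the former by those of the latter. *)

Require Import Defs.
From HB Require Import structures.
From mathcomp Require Import all_boot all_order all_algebra.
From mathcomp Require Import mpoly ring.
From Stdlib Require Import ClassicalEpsilon.

Set Implicit Arguments.
Unset Strict Implicit.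
Unset Printing Implicit Defensive.

Import GRing.Theory.
Local Open Scope ring_scope.

(** * Comparison of resolutions *)

Section Comparison.

Variable R : comNzRingType.

Definition lin_ext (T : finType) (M : lmodType R) (f : T -> M)
    (v : free_module R T) : M :=
  \sum_b v b *: f b.

Lemma lin_ext_is_linear (T : finType) (M : lmodType R) (f : T -> M) :
  linear (lin_ext f).
Proof.
move=> a u v; rewrite /lin_ext scaler_sumr -big_split /=.
by apply: eq_bigr => b _; rewrite !ffunE scalerDl scalerA.
Qed.

HB.instance Definition _ (T : finType) (M : lmodType R) (f : T -> M) :=
  GRing.isLinear.Build R (free_module R T) M _ (lin_ext f)
    (lin_ext_is_linear f).

Definition unit_vec (T : finType) (b : T) : free_module R T :=
  [ffun b' => (b' == b)%:R].

Lemma lin_ext_unit (T : finType) (M : lmodType R) (f : T -> M) (b : T) :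
  lin_ext f (unit_vec b) = f b.
Proof.
rewrite /lin_ext (bigD1 b) //= ffunE eqxx scale1r big1 ?addr0 // => b' nb.
by rewrite ffunE (negbTE nb) scale0r.
Qed.

Lemma lin_ext_comp (T : finType) (M N : lmodType R) (f : T -> M)
    (g : {linear M -> N}) (v : free_module R T) :
  g (lin_ext f v) = lin_ext (g \o f) v.
Proof.
by rewrite /lin_ext linear_sum; apply: eq_bigr => b _; rewrite linearZ.
Qed.

Lemma cdiffE (C : free_complex R) i (v : free_module R (cbasis C i.+1)) :
  cdiff v = lin_ext (@cdiff_basis R C i) v.
Proof. by []. Qed.

Lemma caugE (C : free_complex R) (v : free_module R (cbasis C 0)) :
  caug v = lin_ext (@caug_basis R C : _ -> R^o) v.
Proof. by []. Qed.

Lemma cdiffB (C : free_complex R) i :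
  {morph @cdiff R C i : u v / u - v}.
Proof. exact: (linearB (lin_ext (@cdiff_basis R C i))). Qed.

Lemma caugB (C : free_complex R) : {morph @caug R C : u v / u - v}.
Proof. exact: (linearB (lin_ext (@caug_basis R C : _ -> R^o))). Qed.

Definition cycle (C : free_complex R) (i : nat) :
    free_module R (cbasis C i) -> Prop :=
  match i with
  | 0 => fun v => caug v = 0
  | i.+1 => fun v => cdiff v = 0
  end.

Lemma cycleP (C : free_complex R) (J : R -> Prop) (i : nat)
    (v : free_module R (cbasis C i)) :
  free_resolution C J -> cycle v <-> exists w, cdiff (i := i) w = v.
Proof. by case: i v => [|i] v [_ ex0 ex]; [exact: ex0 | exact: ex]. Qed.

(** Free modules are projective: a preimage is chosen for each basis element and extended
    linearly. *)
Lemma lift_boundary (C : free_complex R) (J : R -> Prop) (i : nat)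
    (T : finType) (f : T -> free_module R (cbasis C i)) :
  free_resolution C J -> (forall b, cycle (f b)) ->
  exists h : T -> free_module R (cbasis C i.+1),
    forall v, cdiff (lin_ext h v) = lin_ext f v.
Proof.
move=> resC fZ.
have ex b : exists w, cdiff (i := i) w = f b by apply/(cycleP _ resC).
exists (fun b => proj1_sig (constructive_indefinite_description _ (ex b))) => v.
rewrite !cdiffE (lin_ext_comp _ (lin_ext _)).
rewrite /lin_ext; apply: eq_bigr => b _ /=; congr (_ *: _).
by case: constructive_indefinite_description.
Qed.

(** * Chain maps, homotopies and ranks of minimal resolutions *)

Section Homotopy.

Variables (K : fieldType) (eps : {rmorphism R -> K}) (J : R -> Prop).

(* [e] is the part [h \o cdiff] of a homotopy from the identity to
   [g \o f]: it is all that has to be remembered of the homotopy to lift the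
   maps one degree further, and it vanishes under [eps] as [C] is minimal. *)
Definition homotopy_state (C D : free_complex R) (i : nat) : Prop :=
  exists (f : cbasis C i -> free_module R (cbasis D i))
         (g : cbasis D i -> free_module R (cbasis C i))
         (e : cbasis C i -> free_module R (cbasis C i)),
  [/\ forall z, cycle z -> cycle (lin_ext f z),
      forall z, cycle z -> cycle (lin_ext g z),
      forall z, cycle (lin_ext g (lin_ext f z) - z - lin_ext e z),
      forall z, cycle z -> lin_ext e z = 0
    & forall b b', eps (e b b') = 0].

Lemma lift_augmentation (C D : free_complex R) :
  free_resolution C J -> free_resolution D J ->
  exists f : cbasis C 0 -> free_module R (cbasis D 0),
    forall v, caug (lin_ext f v) = caug v.
Proof.
move=> [augC _ _] [augD _ _].
have ex b : exists w, caug (C := D) w = caug_basis (f := C) b.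
  by apply/augD/augC; exists (unit_vec b); rewrite caugE lin_ext_unit.
exists (fun b => proj1_sig (constructive_indefinite_description _ (ex b))) => v.
rewrite !caugE (lin_ext_comp _ (lin_ext (_ : _ -> R^o))).
apply: eq_bigr => b _ /=; apply: congr1; rewrite -caugE.
by case: constructive_indefinite_description.
Qed.

Lemma lift_chain_map (C D : free_complex R) (i : nat)
    (f : cbasis C i -> free_module R (cbasis D i)) :
  free_resolution C J -> free_resolution D J ->
  (forall z, cycle z -> cycle (lin_ext f z)) ->
  exists f' : cbasis C i.+1 -> free_module R (cbasis D i.+1),
    forall v, cdiff (lin_ext f' v) = lin_ext f (cdiff v).
Proof.
move=> resC resD fZ.
have [|f' f'E] := lift_boundary (f := lin_ext f \o @cdiff_basis R C i) resD.
  move=> b; apply: fZ; apply/(cycleP _ resC); exists (unit_vec b).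
  by rewrite cdiffE lin_ext_unit.
by exists f' => v; rewrite f'E cdiffE lin_ext_comp.
Qed.

Variables C D : free_complex R.
Hypotheses (resC : free_resolution C J) (resD : free_resolution D J).
Hypothesis minC : forall i (b : cbasis C i.+1) (b' : cbasis C i),
  eps (cdiff_basis b b') = 0.

(** The map [g f - 1 - e] has values in cycles, hence in boundaries; lifting it gives the next
    component [h] of the homotopy. *)
Lemma cycle_lin_ext_sub (i : nat)
    (f : cbasis C i -> free_module R (cbasis D i))
    (g : cbasis D i -> free_module R (cbasis C i))
    (e : cbasis C i -> free_module R (cbasis C i)) :
  (forall z, cycle (lin_ext g (lin_ext f z) - z - lin_ext e z)) ->
  exists h : cbasis C i -> free_module R (cbasis C i.+1),
    forall z, cdiff (lin_ext h z) = lin_ext g (lin_ext f z) - z - lin_ext e z.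
Proof.
move=> gfe.
pose k b := lin_ext g (f b) - unit_vec b - e b.
have [|h hE] := lift_boundary (f := k) resC.
  by move=> b; have := gfe (unit_vec b); rewrite !lin_ext_unit.
exists h => z; rewrite hE /k /lin_ext.
under eq_bigr do rewrite !scalerBr.
rewrite !sumrB; congr (_ - _ - _).
  by rewrite -!/(lin_ext _ _) lin_ext_comp.
apply/ffunP => b; rewrite sum_ffunE (bigD1 b) //= !ffunE eqxx.
rewrite big1 ?addr0 => [|b' nb]; first exact: mulr1.
by rewrite !ffunE eq_sym (negbTE nb); exact: mulr0.
Qed.

(** The new [e'] is [h \o cdiff]. The differential of [g' f' z - z - e' z] reduces to [e (cdiff z)],
    which is 0 because [e] kills cycles. *)
Lemma homotopy_stateP (i : nat) : homotopy_state C D i.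
Proof.
elim: i => [|i [f [g [e [fZ gZ gfe eZ e0]]]]].
  have [f fE] := lift_augmentation resC resD.
  have [g gE] := lift_augmentation resD resC.
  exists f, g, (fun=> 0).
  have z0 z : lin_ext (fun=> 0 : free_module R (cbasis C 0)) z = 0.
    by rewrite /lin_ext big1 // => b _; rewrite scaler0.
  split=> // [z /=|z /=|z|b b']; rewrite ?fE ?gE ?ffunE ?rmorph0 //.
  by rewrite /= z0 subr0 caugB gE fE subrr.
have [f' f'E] := lift_chain_map resC resD fZ.
have [g' g'E] := lift_chain_map resD resC gZ.
have [h hE] := cycle_lin_ext_sub gfe.
have bZ (v : free_module R (cbasis C i.+1)) : cycle (cdiff v).
  by apply/(cycleP _ resC); exists v.
pose e' b := lin_ext h (cdiff_basis (f := C) (i := i) b).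
have e'E v : lin_ext e' v = lin_ext h (cdiff v) by rewrite cdiffE lin_ext_comp.
exists f', g', e'; split=> [z|z|z|z|b b'] /=.
- by rewrite f'E => ->; rewrite linear0.
- by rewrite g'E => ->; rewrite linear0.
- rewrite !cdiffB e'E g'E f'E hE (eZ _ (bZ z)) subr0.
  by rewrite subrr.
- by rewrite e'E => ->; rewrite linear0.
- rewrite /e' /lin_ext sum_ffunE rmorph_sum big1 // => a _.
  by rewrite ffunE rmorphM minC mul0r.
Qed.

(** Under [eps] both [cdiff] and [e] vanish, so [cdiff h = g f - 1 - e] becomes [F *m G = 1] over
    the field, which bounds the size of the identity. *)
Lemma minimal_basis_card_le (i : nat) : (#|cbasis C i| <= #|cbasis D i|)%N.
Proof.
have [f [g [e [_ _ gfe _ e0]]]] := homotopy_stateP i.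
have [h hE] := cycle_lin_ext_sub gfe.
pose F := \matrix_(x < #|cbasis C i|, y < #|cbasis D i|)
  eps (f (enum_val x) (enum_val y)).
pose G := \matrix_(y < #|cbasis D i|, x < #|cbasis C i|)
  eps (g (enum_val y) (enum_val x)).
apply: (@mulmx1_min _ _ _ F G); apply/matrixP => x z; rewrite !mxE.
have := congr1 (fun v : free_module R _ => eps (v (enum_val z)))
  (hE (unit_vec (enum_val x))).
rewrite !lin_ext_unit {1}/cdiff sum_ffunE !ffunE !rmorphB e0 subr0.
rewrite rmorph_sum big1 => [|b _]; last by rewrite ffunE rmorphM minC mulr0.
move/esym/eqP; rewrite subr_eq0 (inj_eq enum_val_inj) rmorph_nat eq_sym => /eqP.
rewrite eq_sym => ->.
rewrite /lin_ext sum_ffunE rmorph_sum.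
rewrite [RHS](reindex _ (onW_bij _ (enum_val_bij _))).
by apply: eq_bigr => y _; rewrite !mxE ffunE rmorphM.
Qed.

End Homotopy.

End Comparison.

(** * Multigraded strands *)

Section Strands.

Variables (K : fieldType) (n : nat).
Implicit Types (u : 'X_{1..n}).

Section Components.

Variables (T : finType) (deg : T -> 'X_{1..n}).
Implicit Types (x : {ffun T -> K}) (v : free_module {mpoly K[n]} T).

Definition strand_supp u x : Prop := forall b, x b != 0 -> (deg b <= u)%MM.

(** In multidegree [u] the summand of [b] is the line spanned by the monomial of exponent
    [u - deg b], or 0 unless [deg b <= u]; these are the coordinates there. *)
Definition strand u v : {ffun T -> K} :=
  [ffun b => if (deg b <= u)%MM then (v b)@_(u - deg b) else 0].

(** Exponent subtraction is truncated, so this is homogeneous of degree [u] only under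
    [strand_supp u x]. *)
Definition strand_lift u x : free_module {mpoly K[n]} T :=
  [ffun b => x b *: 'X_[u - deg b]].

Lemma strandP u v : strand_supp u (strand u v).
Proof. by move=> b; rewrite ffunE; case: ifP => //; rewrite eqxx. Qed.

Definition strand_degs v : seq 'X_{1..n} :=
  undup (flatten [seq [seq (w + deg b)%MM | w <- msupp (v b)] | b <- enum T]).

(** A monomial [w] of the entry at [b] occurs in exactly one strand, that of degree [w + deg b]. *)
Lemma strand_decomp v :
  v = \sum_(u <- strand_degs v) strand_lift u (strand u v).
Proof.
apply/ffunP => b; apply/mpolyP => w; rewrite sum_ffunE raddf_sum /=.
have nz u : u != (w + deg b)%MM -> (strand_lift u (strand u v) b)@_w = 0.
  move=> nu; rewrite !ffunE; case: ifP => [le_u|_]; last by rewrite scale0r mcoeff0.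
  rewrite mcoeffZ mcoeffX; case: eqP => [uw|_]; last by rewrite mulr0.
  by rewrite -uw submK ?eqxx in nu.
have [in_degs|] := boolP ((w + deg b)%MM \in strand_degs v).
  rewrite (bigD1_seq (w + deg b)%MM) ?undup_uniq //= big1 => [|u /nz //].
  by rewrite addr0 !ffunE lem_addl addmK mcoeffZ mcoeffX eqxx mulr1.
move=> notin; rewrite big1_seq => [|u /andP[_ u_in]]; last first.
  by apply: nz; apply: contraNneq notin => <-.
apply/eqP; rewrite mcoeff_eq0; apply: contra notin => w_in.
rewrite mem_undup; apply/flatten_mapP; exists b; first by rewrite mem_enum.
by apply/mapP; exists w.
Qed.

Lemma strand_eq0 v : (forall u, strand u v = 0) -> v = 0.
Proof.
move=> v0; rewrite (strand_decomp v) big1 // => u _; rewrite v0.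
by apply/ffunP => b; rewrite !ffunE scale0r.
Qed.

End Components.

Lemma mcoeff_mulXsub (p : {mpoly K[n]}) (a b u : 'X_{1..n}) :
  (b <= a)%MM -> (b <= u)%MM ->
  (p * 'X_[a - b])@_(u - b) = if (a <= u)%MM then p@_(u - a) else 0.
Proof.
move=> le_ba le_bu; case: ifP => [le_au|nle_au].
  rewrite -(mcoeffMX p (a - b) (u - a)); congr (_@_ _).
  apply/mnmP => i; move/mnm_lepP/(_ i): le_ba; move/mnm_lepP/(_ i): le_au.
  by rewrite !mnmE => h1 h2; rewrite addnC addnBA // subnK.
apply/eqP; rewrite mcoeff_eq0; apply: contraFN nle_au => /msuppM_le.
case/allpairsP => -[w1 w2] /= [_]; rewrite msuppX inE => /eqP -> uE.
rewrite -(submK le_bu) uE -(submK le_ba) addmK -addmA lem_addl //.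
Qed.

Variables (C : free_complex {mpoly K[n]}).
Variables (deg : forall i, cbasis C i -> 'X_{1..n}).
Variables (c : forall i, cbasis C i.+1 -> cbasis C i -> K).
Arguments c : clear implicits.
Arguments deg : clear implicits.

(** The entries of the differential are scalars [c] times monomials, so on every strand its matrix
    is [c], whatever the multidegree. *)
Definition scalar_diff i (x : {ffun cbasis C i.+1 -> K}) :
    {ffun cbasis C i -> K} :=
  [ffun b' => \sum_b x b * c i b b'].

Hypothesis augE : forall b, caug_basis (f := C) b = 'X_[deg 0 b].
Hypothesis diffE : forall i (b : cbasis C i.+1) (b' : cbasis C i),
  cdiff_basis b b' = c i b b' *: 'X_[deg i.+1 b - deg i b'].
Hypothesis deg_le : forall i b b', c i b b' != 0 -> (deg i b' <= deg i.+1 b)%MM.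

Lemma strand_cdiff i u (v : free_module {mpoly K[n]} (cbasis C i.+1)) :
  strand (deg i) u (cdiff v) = scalar_diff (strand (deg i.+1) u v).
Proof.
apply/ffunP => b'; rewrite !ffunE /cdiff sum_ffunE.
case: ifP => [le_u|nle_u]; last first.
  (* If [b'] lies outside the strand, so does every [b] with a nonzero entry at [b']. *)
  rewrite big1 // => b _; rewrite ffunE; case: ifP => le_b; last by rewrite mul0r.
  apply/eqP; rewrite mulf_eq0; apply/orP; right.
  by apply: contraFT nle_u => /deg_le /lepm_trans; apply.
rewrite raddf_sum; apply: eq_bigr => b _ /=; rewrite !ffunE diffE.
have [->|nz] := eqVneq (c i b b') 0.
  by rewrite mulr0 scale0r; apply/eqP; rewrite scaler0 mcoeff0.
rewrite -[X in X@__](scalerAr (c i b b') (v b)) mcoeffZ mulrC; congr (_ * _).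
exact: mcoeff_mulXsub (deg_le nz) le_u.
Qed.

Lemma mcoeff_caug u (v : free_module {mpoly K[n]} (cbasis C 0)) :
  (caug v)@_u = \sum_b strand (deg 0) u v b.
Proof.
rewrite /caug raddf_sum; apply: eq_bigr => b _ /=; rewrite augE ffunE.
have := mcoeff_mulXsub (v b) (a := deg 0 b) (b := 0%MM) (u := u).
by rewrite !subm0 => -> //; apply/mnm_lepP => j; rewrite mnmE.
Qed.

Lemma cdiff_strand_lift i u (x : {ffun cbasis C i.+1 -> K}) :
  strand_supp (deg i.+1) u x ->
  cdiff (strand_lift (deg i.+1) u x) = strand_lift (deg i) u (scalar_diff x).
Proof.
move=> supp_x; apply/ffunP => b'; rewrite /cdiff sum_ffunE !ffunE scaler_suml.
apply: eq_bigr => b _; rewrite !ffunE diffE.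
have [->|nzx] := eqVneq (x b) 0; first by rewrite mul0r !scale0r.
have [->|nz] := eqVneq (c i b b') 0; first by rewrite mulr0 !scale0r scaler0.
rewrite -[LHS]/((x b *: 'X_[_]) * (c i b b' *: 'X_[_])).
rewrite -scalerAl -scalerAr scalerA -mpolyXD; congr (_ *: 'X_[_]).
have := deg_le nz; have := supp_x _ nzx => /mnm_lepP le1 /mnm_lepP le2.
by apply/mnmP => j; rewrite !mnmE addnBA ?subnK ?le1 ?le2.
Qed.

(** Finitely many strands make up [v]; preimages are chosen in each of them and their lifts
    added. *)
Lemma strand_exact i (v : free_module {mpoly K[n]} (cbasis C i)) :
  (forall u, exists2 y, strand_supp (deg i.+1) u y &
     scalar_diff y = strand (deg i) u v) ->
  exists w, cdiff (i := i) w = v.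
Proof.
move=> ex.
have ex' u : exists y,
    strand_supp (deg i.+1) u y /\ scalar_diff y = strand (deg i) u v.
  by have [y] := ex u; exists y.
pose y u := proj1_sig (constructive_indefinite_description _ (ex' u)).
have yP u : strand_supp (deg i.+1) u (y u) /\
    scalar_diff (y u) = strand (deg i) u v.
  by rewrite /y; case: constructive_indefinite_description.
exists (\sum_(u <- strand_degs (deg i) v) strand_lift (deg i.+1) u (y u)).
rewrite cdiffE linear_sum [RHS](strand_decomp (deg i)); apply: eq_bigr => u _.
by have [supp_y <-] := yP u; rewrite -cdiff_strand_lift.
Qed.

Lemma free_resolution_strands (J : {mpoly K[n]} -> Prop) :
  (forall f, J f <-> exists v, caug (C := C) v = f) ->
  (forall x : {ffun cbasis C 1 -> K}, \sum_b scalar_diff x b = 0) ->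
  (forall i (x : {ffun cbasis C i.+2 -> K}),
     scalar_diff (scalar_diff x) = 0) ->
  (forall u x, strand_supp (deg 0) u x -> \sum_b x b = 0 ->
     exists2 y, strand_supp (deg 1) u y & scalar_diff y = x) ->
  (forall i u x, strand_supp (deg i.+1) u x -> scalar_diff x = 0 ->
     exists2 y, strand_supp (deg i.+2) u y & scalar_diff y = x) ->
  free_resolution C J.
Proof.
move=> augJ aug_d dd ex0 ex; split=> // [v|i v]; split=> [v0|[w <-]].
- apply: strand_exact => u; apply: ex0 (@strandP _ _ _ _) _.
  by rewrite -mcoeff_caug v0 mcoeff0.
- by apply/mpolyP => u; rewrite mcoeff_caug strand_cdiff aug_d mcoeff0.
- apply: strand_exact => u; apply: ex (@strandP _ _ _ _) _.
  rewrite -strand_cdiff v0.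
  by apply/ffunP => b; rewrite !ffunE mcoeff0 if_same.
- by apply: (strand_eq0 (deg := deg i)) => u; rewrite !strand_cdiff dd.
Qed.

Lemma multigraded_monomial_entries : multigraded deg.
Proof.
split=> [b u|i b b' u]; first by rewrite augE => /mem_msuppXP.
rewrite diffE; have [->|nz] := eqVneq (c i b b') 0.
  by rewrite scale0r msupp0.
by move=> /msuppZ_le /mem_msuppXP <-; rewrite submK // deg_le.
Qed.

(** The monomial of an entry is 1 only if both degrees agree. *)
Lemma minimal_monomial_entries :
  (forall i b b', c i b b' != 0 -> deg i b' != deg i.+1 b) -> minimal C.
Proof.
move=> deg_neq i b b'; rewrite diffE mcoeffZ mcoeffX.
have [->|nz] := eqVneq (c i b b') 0; first by rewrite mul0r.
case: eqP => [deg0|]; last by rewrite mulr0.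
have := deg_neq i b b' nz; rewrite -(submK (deg_le nz)) deg0 add0m.
by rewrite eqxx.
Qed.

End Strands.

(** * The strand complex of symbols *)

Section SetMax.

Variable r : nat.
Implicit Types (s t A : {set 'I_r}) (i j x : 'I_r).

Lemma setmax_le i A : i \in A -> (i < setmax A)%N.
Proof. by move=> Ai; rewrite /setmax (bigD1 i) //= leq_maxl. Qed.

Lemma setmax_leqP A (n : nat) :
  reflect (forall i, i \in A -> i < n)%N (setmax A <= n)%N.
Proof. by apply: (iffP (bigmax_leqP _ _ _)). Qed.

Lemma setmax0 : setmax (set0 : {set 'I_r}) = 0%N.
Proof. by rewrite /setmax big_set0. Qed.

Lemma setmaxU1 i A : setmax (i |: A) = maxn i.+1 (setmax A).
Proof.
apply/eqP; rewrite eqn_leq geq_max setmax_le ?setU11 //=.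
apply/andP; split; apply/setmax_leqP => j.
  by rewrite in_setU1 leq_max => /predU1P[->|/setmax_le ->]; rewrite ?leqnn ?orbT.
by move=> Aj; rewrite setmax_le // setU1r.
Qed.

Lemma setmaxS s t : s \subset t -> (setmax s <= setmax t)%N.
Proof. by move=> /subsetP st; apply/setmax_leqP => i /st/setmax_le. Qed.

Lemma setmax_in A : (0 < setmax A)%N -> exists2 x, x \in A & setmax A = x.+1.
Proof.
have [->|nz _] := eqVneq A set0; first by rewrite setmax0.
rewrite -card_gt0 in nz.
have [x Ax E] := eq_bigmax_cond (fun i : 'I_r => i.+1) nz.
by exists x.
Qed.

Lemma setmax_gt0 A : (0 < setmax A)%N = (A != set0).
Proof.
apply/idP/idP => [/setmax_in[x Ax _]|/set0Pn[x /setmax_le]]; last exact: leq_ltn_trans.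
by apply/set0Pn; exists x.
Qed.

Lemma del_maxE A x : x \in A -> setmax A = x.+1 -> del_max A = A :\ x.
Proof.
by move=> Ax E; apply/setP => i; rewrite !inE E eqSS andbC.
Qed.

Lemma topE A x : x \in A -> setmax A = x.+1 -> top A = [set x].
Proof.
move=> Ax E; apply/setP => i; rewrite !inE E eqSS -val_eqE /=.
by case: eqP => [/val_inj ->|]; rewrite ?Ax ?andbF.
Qed.

Lemma del_max_sub A : del_max A \subset A.
Proof. by apply/subsetP => i; rewrite inE => /andP[]. Qed.

Lemma sgn_D1 j l t : j \in t -> sgn l t = ((l < j)%N + sgn l (t :\ j))%N.
Proof.
move=> tj; rewrite /sgn (cardsD1 j) !inE tj /=; congr (_ + _)%N.
by apply: eq_card => i; rewrite !inE andbA.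
Qed.

Lemma sgn_max j t : (forall i, i \in t -> i <= j)%N -> sgn j t = 0%N.
Proof.
move=> le_j; apply/eqP; rewrite cards_eq0; apply/eqP/setP => i; rewrite !inE.
by apply/negP => /andP[/le_j]; rewrite leqNgt => /negP.
Qed.

(** The terms for [(j, l)] and [(l, j)] cancel: removing the larger element lowers [sgn] of the
    smaller by one, while removing the smaller leaves [sgn] of the larger unchanged. *)
Lemma sgn_sum_eq0 (K : pzRingType) t (F : 'I_r -> 'I_r -> K) :
  (forall j l, j \in t -> l \in t -> j != l -> F j l = F l j) ->
  \sum_(j in t) \sum_(l in t :\ j)
    (-1) ^+ sgn j t * ((-1) ^+ sgn l (t :\ j) * F j l) = 0.
Proof.
move=> symF; pose G j l : K := (-1) ^+ sgn j t * ((-1) ^+ sgn l (t :\ j) * F j l).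
have -> : \sum_(j in t) \sum_(l in t :\ j) G j l =
    \sum_(j in t) \sum_(l in t | (l < j)%N) G j l
  + \sum_(j in t) \sum_(l in t | (j < l)%N) G j l.
  rewrite -big_split /=; apply: eq_bigr => j _.
  rewrite (bigID (fun l : 'I_r => (l < j)%N)) /=; congr (_ + _);
    apply: eq_bigl => l; rewrite !inE -val_eqE /=; case: (l \in t);
    by rewrite ?andbF ?andbT //=; case: ltngtP.
rewrite [X in _ + X](exchange_big_dep (fun l => l \in t)) //= => [|i j _ /andP[]//].
rewrite -big_split big1 //= => j tj; rewrite tj -big_split big1 //= => l.
move=> /andP[tl lj]; rewrite /G (symF j l) //; last first.
  by apply: contraTneq lj => ->; rewrite ltnn.
rewrite [sgn l t](sgn_D1 _ tj) lj [sgn j t](sgn_D1 _ tl).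
rewrite (ltnNge j) (ltnW lj) /= add0n exprD expr1 mulN1r mulNr.
by rewrite !mulrA -!exprD addnC subrr.
Qed.

End SetMax.

(** * The scalar differential and its square *)

Section ScalarComplex.

Variables (K : fieldType) (r k : nat).
Hypothesis k_gt0 : (0 < k)%N.
Implicit Types (s t A : {set 'I_r}) (j l : 'I_r).
Local Notation pair := ({set 'I_r} * {set 'I_r})%type.
Implicit Types (p q : pair) (v w : {ffun pair -> K}).

Definition is_symb p : bool :=
  [&& [disjoint p.1 & p.2], #|p.1| == k & (setmax p.2 < setmax p.1)%N].

Definition shift s j : {set 'I_r} := j |: del_max s.

Definition elt s t q : K := (is_symb (s, t) && (q == (s, t)))%:R.

(* The two cases of the differential of a symbol agree with this uniform sum,
   since [elt s t] is 0 if [(s, t)] is not a symbol. *)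
Definition sdiff_elt p q : K :=
  \sum_(j in p.2) (-1) ^+ sgn j p.2 *
    (elt (shift p.1 j) (p.2 :\ j) q - elt p.1 (p.2 :\ j) q).

(* All homological degrees at once; the degree of [(s, t)] is #|t|. *)
Definition sdiff v : {ffun pair -> K} := [ffun q => \sum_p v p * sdiff_elt p q].

Lemma sdiffB : {morph sdiff : v w / v - w}.
Proof.
move=> v w; apply/ffunP => q; rewrite !ffunE -sumrB.
by apply: eq_bigr => p _; rewrite !ffunE mulrBl.
Qed.

Lemma elt_neq0 s t q : elt s t q != 0 -> is_symb (s, t) /\ q = (s, t).
Proof.
by rewrite /elt; case: andP => [[? /eqP]|]; rewrite ?eqxx.
Qed.

Lemma symb_setmaxP s : #|s| = k ->
  exists x, [/\ x \in s, setmax s = x.+1, del_max s = s :\ x & top s = [set x]].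
Proof.
move=> cs; have : (0 < setmax s)%N by rewrite setmax_gt0 -card_gt0 cs.
by case/setmax_in => x xs E; exists x; split; rewrite ?(del_maxE xs) ?(topE xs).
Qed.

Lemma card_shift s j : #|s| = k -> j \notin s -> #|shift s j| = k.
Proof.
move=> cs js; have [x [xs _ dE _]] := symb_setmaxP cs.
by rewrite cardsU1 dE !inE negb_and js orbT -cs (cardsD1 x s) xs.
Qed.

Lemma disjointD1l s t j : [disjoint s & t] -> [disjoint s & t :\ j].
Proof. exact: disjointWr (subsetDl _ _). Qed.

Lemma is_symbD1 s t j : is_symb (s, t) -> is_symb (s, t :\ j).
Proof.
case/and3P => /= dst cs lt; rewrite /is_symb /= cs disjointD1l //=.
by rewrite (leq_ltn_trans _ lt) ?setmaxS ?subsetDl.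
Qed.

Lemma disjoint_notin s t j : [disjoint s & t] -> j \in t -> j \notin s.
Proof. by move=> dst jt; rewrite (disjointFl dst jt). Qed.

Lemma is_symb_shift s t t' j : is_symb (s, t) -> j \in t -> j \notin t' ->
  t' \subset t ->
  is_symb (shift s j, t') = (setmax t' < maxn j.+1 (setmax (del_max s)))%N.
Proof.
case/and3P => /= dst /eqP cs _ jt jt' t't; rewrite /is_symb /=.
rewrite card_shift ?(disjoint_notin dst jt) // eqxx setmaxU1.
rewrite disjoints_subset subUset sub1set inE jt' -disjoints_subset.
by rewrite (disjointW (del_max_sub s) t't).
Qed.

(** After the first shift the maximum is still that of [del_max s], so the second shift removes it
    and keeps [j]. *)
Lemma shift_shift_lt s j l : (j.+1 < setmax (del_max s))%N ->
  shift (shift s j) l = l |: (j |: del_max (del_max s)).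
Proof.
move=> jlt; congr (_ |: _).
have [|x xs E] := @setmax_in _ (del_max s); first exact: leq_ltn_trans jlt.
have jx : j != x by apply: contraTneq jlt => ->; rewrite E ltnn.
rewrite (del_maxE xs E) (@del_maxE _ (shift s j) x) ?setU1r //.
  apply/setP => i; rewrite !inE; case: (eqVneq i x) => [->|]; rewrite ?andbF //=.
  by rewrite eq_sym (negbTE jx).
by rewrite setmaxU1 E; apply/maxn_idPr; rewrite -E ltnW.
Qed.

(** Here [j] is the maximum of [shift s j], so the second shift discards it again. *)
Lemma shift_shift_ge s j l : j \notin del_max s ->
  (setmax (del_max s) < j.+1)%N -> shift (shift s j) l = shift s l.
Proof.
move=> js ltj; rewrite {1}/shift (@del_maxE _ _ j) ?setU11 ?setU1K //.
by rewrite setmaxU1; apply/maxn_idPl/ltnW.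
Qed.
Lemma sum_elt s t (f : pair -> K) :
  \sum_q elt s t q * f q = if is_symb (s, t) then f (s, t) else 0.
Proof.
rewrite (bigD1 (s, t)) //= big1 => [|q nq]; last first.
  by rewrite /elt (negbTE nq) andbF mul0r.
by rewrite /elt eqxx andbT addr0; case: is_symb; rewrite ?mul1r ?mul0r.
Qed.

(* The coefficient of the term of the square of the differential that removes
   first [j] and then [l]. *)
Definition sdiff2_elt s t q j l : K :=
  (if is_symb (shift s j, t :\ j) then
     elt (shift (shift s j) l) (t :\ j :\ l) q - elt (shift s j) (t :\ j :\ l) q
   else 0)
  - (elt (shift s l) (t :\ j :\ l) q - elt s (t :\ j :\ l) q).

(** This symmetry makes the square of the differential cancel in pairs. The cases differ in which
    shifts are symbols. *)
Lemma sdiff2_eltC s t q j l : is_symb (s, t) -> j \in t -> l \in t -> j != l ->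
  sdiff2_elt s t q j l = sdiff2_elt s t q l j.
Proof.
move=> st; wlog lt_lj : j l / (l < j)%N.
  move=> th jt lt nlj; have [lt_lj|lt_jl|/val_inj jl] := ltngtP l j; first exact: th.
    by apply/esym/th; rewrite // eq_sym.
  by rewrite jl eqxx in nlj.
move=> jt lt njl; have tC : t :\ l :\ j = t :\ j :\ l.
  by rewrite !setDDl setUC.
have /and3P[/= dst /eqP cs lts] := st.
have tjj : j \notin t :\ j by rewrite !inE eqxx.
have tll : l \notin t :\ l by rewrite !inE eqxx.
have subj : t :\ j \subset t by exact: subsetDl.
have subl : t :\ l \subset t by exact: subsetDl.
have sub2 : t :\ j :\ l \subset t by exact: subset_trans (subsetDl _ _) subj.
have j2 : j \notin t :\ j :\ l by rewrite !inE eqxx !andbF.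
have l2 : l \notin t :\ j :\ l by rewrite !inE eqxx.
rewrite /sdiff2_elt tC !(is_symb_shift st) //.
(* In the first case all shifts are symbols, and a double shift replaces the two largest elements of
   [s] in either order. *)
have [ltt|] := ltnP (setmax t) (setmax (del_max s)).
  have lt_max i (i_t : i \in t) : (i.+1 < setmax (del_max s))%N.
    exact: leq_ltn_trans (setmax_le i_t) ltt.
  rewrite !leq_max !(leq_ltn_trans (setmaxS _) ltt) ?orbT //.
  rewrite (shift_shift_lt _ (lt_max j jt)) (shift_shift_lt _ (lt_max l lt)).
  by rewrite setUCA; ring.
move=> le_st.
have [x xt E] : exists2 x, x \in t & setmax t = x.+1.
  by apply: setmax_in; apply: leq_ltn_trans (setmax_le jt).
(* Equality is excluded because [s] and [t] are disjoint. *)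
have lt_st : (setmax (del_max s) < x.+1)%N.
  rewrite ltn_neqAle -E le_st andbT; apply/eqP => E'.
  have [|y ys Ey] := @setmax_in _ (del_max s); first by rewrite E' E.
  have yx : y = x by apply/val_inj; move: E'; rewrite Ey E => -[].
  have := disjoint_notin dst xt.
  by rewrite -yx (subsetP (del_max_sub s)).
(* Both [j] and the maximum [x] of [t] survive in [t :\ l], so shifting by [l] first gives no
   symbol. *)
have Sl : (setmax (t :\ l) < maxn l.+1 (setmax (del_max s)))%N = false.
  apply/negP; rewrite leq_max; apply/negP; rewrite negb_or -!leqNgt.
  have jtl : j \in t :\ l by rewrite !inE njl.
  rewrite (leq_trans (_ : l < j.+1)%N) ?setmax_le //=; last exact: ltnW.
  have [xl|nxl] := eqVneq x l.
    by have := setmax_le jt; rewrite E xl ltnNge lt_lj.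
  by apply: leq_trans (ltnW lt_st) _; apply: setmax_le; rewrite !inE nxl.
rewrite Sl; case: ifP => [Sj|/negbT].
  have ltj : (setmax (del_max s) < j.+1)%N.
    have [<- //|nxj] := eqVneq x j.
    have xtj : x \in t :\ j by rewrite !inE nxj.
    move: (leq_ltn_trans (setmax_le xtj) Sj); rewrite leq_max.
    case/orP => [xj|]; first exact: ltn_trans lt_st xj.
    by rewrite ltnNge ltnW.
  (* The double shift equals [shift s l], so these two terms cancel; what remains is the value with
     [l] first. *)
  rewrite shift_shift_ge //; first by ring.
  by apply: contra (disjoint_notin dst jt) => /(subsetP (del_max_sub s)).
rewrite ltnNge negbK geq_max => /andP[].
(* The maximum [y] of [t :\ j] is above [j], hence is not [l]; it stays after both removals and
   rules out both shifts as symbols. *)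
move=> le_j le_s; have [|y ytj Ey] := @setmax_in _ (t :\ j).
  exact: leq_trans le_j.
have yt2 : y \in t :\ j :\ l.
  rewrite in_setD1 ytj andbT; apply: contraTneq le_j => yl.
  by rewrite Ey yl -ltnNge ltnS.
have not_symb i : i \in t -> i \notin t :\ j :\ l -> (i <= j)%N ->
    elt (shift s i) (t :\ j :\ l) q = 0.
  move=> it i2 le_ij; rewrite /elt (is_symb_shift st) // ltnNge geq_max.
  rewrite (leq_trans _ (setmax_le yt2)) -?Ey ?(leq_trans _ le_j) //=.
  by rewrite Ey in le_s; rewrite (leq_trans le_s (setmax_le yt2)).
by rewrite !not_symb // ltnW.
Qed.

Lemma sdiff_elt_sq p q : is_symb p -> \sum_q' sdiff_elt p q' * sdiff_elt q' q = 0.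
Proof.
case: p => s t st; rewrite -[RHS](sgn_sum_eq0 (t := t) (F := sdiff2_elt s t q)).
  under eq_bigr do rewrite mulr_suml.
  rewrite exchange_big; apply: eq_bigr => j jt /=.
  under eq_bigr do rewrite -mulrA mulrBl.
  rewrite -mulr_sumr sumrB !sum_elt (is_symbD1 _ st) -[RHS]mulr_sumr.
  congr (_ * _).
  rewrite /sdiff2_elt; case: is_symb.
    rewrite -sumrB; apply: eq_bigr => l _ /=; rewrite -mulrBr.
    by congr (_ * _); rewrite !opprB.
  by rewrite sub0r -sumrN; apply: eq_bigr => l _; rewrite sub0r mulrN.
by move=> j l jt lt njl; apply: sdiff2_eltC.
Qed.

Definition supp_in A v : Prop :=
  forall p, v p != 0 -> is_symb p /\ p.1 :|: p.2 \subset A.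

Lemma sdiff_sdiff A v : supp_in A v -> sdiff (sdiff v) = 0.
Proof.
move=> suppv; apply/ffunP => q; rewrite !ffunE.
under eq_bigr do rewrite ffunE mulr_suml.
rewrite exchange_big big1 //= => p _; under eq_bigr do rewrite -mulrA.
rewrite -mulr_sumr; have [->|/suppv[st _]] := eqVneq (v p) 0.
  by rewrite mul0r.
by rewrite sdiff_elt_sq ?mulr0.
Qed.

Lemma sdiff_elt_neq0 p q : sdiff_elt p q != 0 ->
  exists2 j, j \in p.2 &
    is_symb q /\ (q = (shift p.1 j, p.2 :\ j) \/ q = (p.1, p.2 :\ j)).
Proof.
move=> nz; have [/exists_inP[j jt]|] := boolP [exists j in p.2,
  elt (shift p.1 j) (p.2 :\ j) q - elt p.1 (p.2 :\ j) q != 0].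
  have [->|/elt_neq0[qs ->] _] := eqVneq (elt (shift p.1 j) (p.2 :\ j) q) 0.
    rewrite sub0r oppr_eq0 => /elt_neq0[qs ->].
    by exists j => //; split=> //; right.
  by exists j => //; split=> //; left.
rewrite negb_exists_in => /forall_inP nex; case/eqP: nz.
rewrite /sdiff_elt big1 // => j /nex; rewrite negbK => /eqP ->.
by rewrite mulr0.
Qed.

Lemma sdiff_neq0 v q : sdiff v q != 0 -> exists2 p, v p != 0 & sdiff_elt p q != 0.
Proof.
move=> nz; have [/existsP[p /andP[]]|] :=
  boolP [exists p, (v p != 0) && (sdiff_elt p q != 0)]; first by exists p.
rewrite negb_exists => /forallP nex; case/eqP: nz.
rewrite ffunE big1 // => p _; apply/eqP; have := nex p.
by rewrite mulf_eq0 negb_and !negbK.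
Qed.

Lemma sdiff_elt_sub p q :
  sdiff_elt p q != 0 -> q.1 :|: q.2 \subset p.1 :|: p.2.
Proof.
case/sdiff_elt_neq0 => j jp [_ [->|->]] /=; last exact: setUS (subsetDl _ _).
rewrite !subUset sub1set inE jp orbT /=.
rewrite (subset_trans (del_max_sub _) (subsetUl _ _)).
by rewrite (subset_trans (subsetDl _ _) (subsetUr _ _)).
Qed.

Lemma supp_in_sdiff A v : supp_in A v -> supp_in A (sdiff v).
Proof.
move=> suppv q /sdiff_neq0[p /suppv[ps pA] nz].
split; first by have [j _ []] := sdiff_elt_neq0 nz.
exact: subset_trans (sdiff_elt_sub nz) pA.
Qed.

Lemma supp_inB A v w : supp_in A v -> supp_in A w -> supp_in A (v - w).
Proof.
move=> suppv suppw q; rewrite !ffunE.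
by have [-> |/suppv//] := eqVneq (v q) 0; rewrite sub0r oppr_eq0 => /suppw.
Qed.

Definition saug v : K := \sum_(q | q.2 == set0) v q.

Lemma saugB : {morph saug : v w / v - w}.
Proof. by move=> v w; rewrite /saug -sumrB; apply: eq_bigr => q _; rewrite !ffunE. Qed.

Lemma saug_elt s t : is_symb (s, t) -> \sum_(q | q.2 == set0) elt s t q = (t == set0)%:R.
Proof.
move=> st; rewrite big_mkcond (bigD1 (s, t)) //= big1 ?addr0 => [|q nq].
  by rewrite /elt eqxx st; case: eqP.
by rewrite /elt (negbTE nq) andbF if_same.
Qed.

Lemma saug_sdiff A v : supp_in A v -> saug (sdiff v) = 0.
Proof.
move=> suppv; rewrite /saug; under eq_bigr do rewrite ffunE.
rewrite exchange_big big1 //= => -[s t] _; rewrite -mulr_sumr.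
have [->|/suppv[st _]] := eqVneq (v (s, t)) 0; first by rewrite mul0r.
rewrite /sdiff_elt exchange_big big1 ?mulr0 //= => j jt.
rewrite -mulr_sumr sumrB (saug_elt (is_symbD1 j st)).
have [tj0|nz] := eqVneq (t :\ j) set0.
  (* With nothing left in [t] the shifted pair is always a symbol, since [setmax set0 = 0]; the two
     terms then cancel. *)
  have sj0 : is_symb (shift s j, set0).
    by rewrite (is_symb_shift st) ?inE ?sub0set ?setmax0 ?leq_max.
  by rewrite tj0 saug_elt // eqxx subrr mulr0.
rewrite subr0 big1 ?mulr0 // => q /eqP q0; apply/eqP/negPn/negP => /elt_neq0[_ qE].
by move: q0 nz; rewrite qE /= => ->; rewrite eqxx.
Qed.

(** * Exactness by induction on the weight *)

Definition gap A s : {set 'I_r} :=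
  [set j in A | (j \notin s) && (j.+1 < setmax s)%N].

(* The value 0 on the initial segment makes [weight_shift] and the base case of
   [scalar_exact] uniform. *)
Definition weight A s : nat :=
  if gap A s == set0 then 0%N else (\sum_(i in s) i.+1)%N.

(** Together with [gap_symb]: for fixed [s] inside [A], the symbols inside [A] are the faces of the
    full simplex on [gap A s]. *)
Lemma symb_sub_gap A s t :
  is_symb (s, t) -> s :|: t \subset A -> t \subset gap A s.
Proof.
case/and3P => /= dst _ lt; rewrite subUset => /andP[_ /subsetP tA].
apply/subsetP => j jt; rewrite inE tA // (disjoint_notin dst jt) /=.
exact: leq_ltn_trans (setmax_le jt) lt.
Qed.

Lemma gap_symb A s t : #|s| = k -> t \subset gap A s -> is_symb (s, t).
Proof.
move=> cs tg; rewrite /is_symb /= cs eqxx; apply/andP; split.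
  rewrite disjoint_sym disjoints_subset; apply: subset_trans tg _.
  by apply/subsetP => j; rewrite !inE => /and3P[].
have [x [xs E _ _]] := symb_setmaxP cs.
rewrite E ltnS; apply/setmax_leqP => j /(subsetP tg).
by rewrite inE E => /and3P[].
Qed.

(** The maximum of [s] is traded for the smaller [j], which lowers the sum; as [gap A s] contains
    [j], [weight A s] is that sum. *)
Lemma weight_shift A s j : #|s| = k -> j \in gap A s ->
  (weight A (shift s j) < weight A s)%N.
Proof.
move=> cs jg; have [x [xs E dE _]] := symb_setmaxP cs.
have lt_sum : (\sum_(i in shift s j) i.+1 < \sum_(i in s) i.+1)%N.
  move: jg; rewrite inE => /and3P[_ js]; rewrite E ltnS => jx.
  rewrite (big_setD1 x xs) /= big_setU1 ?dE ?inE ?negb_and ?js ?orbT //=.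
  by rewrite ltn_add2r.
rewrite /weight; case: (eqVneq (gap A s)) jg => [->|_ _]; first by rewrite inE.
by case: ifP => // _; apply: leq_ltn_trans lt_sum.
Qed.

(** An empty gap means that the set contains all elements of [A] up to its maximum, so two such sets
    are nested. *)
Lemma gap0_inj A s s' : #|s| = k -> #|s'| = k -> s \subset A -> s' \subset A ->
  gap A s = set0 -> gap A s' = set0 -> s = s'.
Proof.
wlog le_ss' : s s' / (setmax s <= setmax s')%N.
  move=> th *; case: (leqP (setmax s) (setmax s')) => [|/ltnW] le; first exact: th.
  by apply/esym/th.
move=> cs cs' sA _ _ g0; apply/eqP; rewrite eqEcard cs cs' leqnn andbT.
apply/subsetP => i is_; have [x [xs' E _ _]] := symb_setmaxP cs'.
have := in_set0 i; rewrite -g0 inE (subsetP sA) //= E ltnS.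
apply: contraFT => is'; rewrite is' /= ltn_neqAle.
rewrite -ltnS -E (leq_trans (setmax_le is_)) // andbT.
by apply: contraNneq is' => /val_inj ->.
Qed.

Lemma sgnU1 j t : j \notin t -> sgn j (j |: t) = sgn j t.
Proof. by move=> jt; rewrite (sgn_D1 _ (setU11 j t)) ltnn setU1K. Qed.

(* In maximal weight only the simplicial part of the differential survives. *)
Lemma sdiff_max_weight A v s t :
  supp_in A v -> (forall p, v p != 0 -> (weight A p.1 <= weight A s)%N) ->
  is_symb (s, t) ->
  sdiff v (s, t) = - \sum_(j | j \notin t) (-1) ^+ sgn j t * v (s, j |: t).
Proof.
move=> suppv le_wt st; rewrite ffunE.
transitivity (\sum_(p : pair) \sum_(j in p.2)
    - ((-1) ^+ sgn j p.2 * (v p * elt p.1 (p.2 :\ j) (s, t)))).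
  apply: eq_bigr => p _; rewrite mulr_sumr; apply: eq_bigr => j jp.
  have [->|nz] := eqVneq (v p) 0; first by rewrite !mul0r mulr0 oppr0.
  have [ps pA] := suppv p nz; have [->|] := eqVneq (elt (shift p.1 j) (p.2 :\ j) (s, t)) 0.
    by rewrite sub0r !mulrN mulrCA.
  (* A shifted term landing on [s] would come from a symbol of weight above that of [s]. *)
  case/elt_neq0 => _ [sE _]; have := le_wt p nz; rewrite leqNgt sE weight_shift //.
    by case/and3P: ps => _ /eqP.
  by rewrite (subsetP (symb_sub_gap _ pA)) // -surjective_pairing.
rewrite (exchange_big_dep predT) //= -sumrN.
rewrite [RHS]big_mkcond /=; apply: eq_bigr => j _.
have elt0 p : j \in p.2 -> elt p.1 (p.2 :\ j) (s, t) != 0 ->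
    j \notin t /\ p = (s, j |: t).
  case: p => s' t' /= jt' /elt_neq0[_ [-> ->]].
  by rewrite setD1K // !inE eqxx.
case: ifPn => jt; last first.
  rewrite big1 // => p jp; have [->|/(elt0 _ jp)[]] := eqVneq (elt p.1 (p.2 :\ j) (s, t)) 0.
    by rewrite !mulr0 oppr0.
  by rewrite (negbTE jt).
rewrite (bigD1 (s, j |: t)) ?setU11 //= big1 => [|p /andP[jp np]]; last first.
  have [->|/(elt0 _ jp)[_ pE]] := eqVneq (elt p.1 (p.2 :\ j) (s, t)) 0;
    last by rewrite pE eqxx in np.
  by rewrite !mulr0 oppr0.
by rewrite addr0 setU1K // sgnU1 // /elt st eqxx mulr1.
Qed.

Definition top_gap A s : option 'I_r :=
  [pick p in gap A s | p.+1 == setmax (gap A s)].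

(** The cone with apex the largest vertex [p], taken on weight [N] only. Adding the largest element
    costs no sign; the minus offsets that of the simplicial terms in [sdiff_elt]. *)
Definition homotopy_coef A (N : nat) v q : K :=
  if top_gap A q.1 is Some p then
    if (p \in q.2) && (weight A q.1 == N) then - v (q.1, q.2 :\ p) else 0
  else 0.

Definition homotopy A N v : {ffun pair -> K} := [ffun q => homotopy_coef A N v q].

Lemma homotopy_neq0 A N v q : homotopy A N v q != 0 ->
  exists x, [/\ x \in gap A q.1, x \in q.2, weight A q.1 = N
              & v (q.1, q.2 :\ x) != 0].
Proof.
rewrite ffunE /homotopy_coef /top_gap; case: pickP => [p /andP[pg _]|];
  last by rewrite eqxx.
case: ifP => [/andP[pq /eqP wq]|]; last by rewrite eqxx.
by rewrite oppr_eq0 => nz; exists p.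
Qed.

Lemma supp_in_homotopy A N v : supp_in A v -> supp_in A (homotopy A N v).
Proof.
move=> suppv [s t] /homotopy_neq0[/= p [pg pt wq /suppv[/= st]]].
rewrite subUset => /andP[sA tA].
have tg : t \subset gap A s.
  rewrite -(setD1K pt) subUset sub1set pg (symb_sub_gap st) //.
  by rewrite subUset sA.
split; first by case/and3P: st => _ /eqP cs _; apply: gap_symb cs tg.
rewrite subUset sA -(setD1K pt) subUset tA sub1set.
by move: pg; rewrite inE => /and3P[->].
Qed.

(** Coning contracts the simplex, so in top weight the boundary of the cone over a cycle gives the
    cycle back. *)
Lemma sdiff_homotopy A v s t :
  supp_in A v -> (forall p, v p != 0 -> (weight A p.1 <= weight A s)%N) ->
  (0 < weight A s)%N -> sdiff v = 0 -> is_symb (s, t) ->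
  sdiff (homotopy A (weight A s) v) (s, t) = v (s, t).
Proof.
move=> suppv le_wt wt_gt0 dv0 st; set w := homotopy _ _ _.
have suppw : supp_in A w by exact: supp_in_homotopy.
have le_ww p : w p != 0 -> (weight A p.1 <= weight A s)%N.
  by case/homotopy_neq0 => x [_ _ ->].
rewrite (sdiff_max_weight suppw le_ww st).
have [p [pg Ep]] : exists x, x \in gap A s /\ top_gap A s = Some x.
  rewrite /top_gap; case: pickP => [p /andP[pg _]|]; first by exists p.
  move: wt_gt0; rewrite /weight; case: eqP => // /eqP; rewrite -setmax_gt0.
  by case/setmax_in => x xg xE _ /(_ x); rewrite /= xg xE eqxx.
have p_max j : j \in gap A s -> (j <= p)%N.
  move: Ep; rewrite /top_gap; case: pickP => // x /andP[_ /eqP xE] [<-].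
  by move/setmax_le; rewrite -xE.
have wE t' : w (s, t') = if p \in t' then - v (s, t' :\ p) else 0.
  by rewrite ffunE /homotopy_coef /= Ep eqxx andbT.
have vgap t' : v (s, t') != 0 -> t' \subset gap A s.
  by case/suppv => st' sA; apply: symb_sub_gap st' sA.
have sgnp t' : v (s, t') != 0 -> sgn p t' = 0%N.
  by move=> /vgap/subsetP t'g; apply: sgn_max => i /t'g/p_max.
(* If [p] is not in [t], only the term that adds [p] contributes. *)
have [pt|pt] := boolP (p \in t); last first.
  rewrite (bigD1 p) //= big1 => [|j /andP[jt jp]]; last first.
    by rewrite wE in_setU1 (negbTE pt) eq_sym (negbTE jp) mulr0.
  rewrite wE setU11 setU1K // addr0 mulrN opprK.
  have [->|nz] := eqVneq (v (s, t)) 0; first by rewrite mulr0.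
  by rewrite sgnp // mul1r.
have st' : is_symb (s, t :\ p) := is_symbD1 p st.
(* If [p] is in [t], the cycle condition at [t :\ p] expresses [v (s, t)] by the remaining terms,
   which are those of the boundary of the cone. *)
have := congr1 (fun f : {ffun pair -> K} => f (s, t :\ p)) dv0.
rewrite /= (sdiff_max_weight suppv le_wt st') ffunE => /eqP.
have pp : p \notin t :\ p by rewrite !inE eqxx.
rewrite oppr_eq0 (bigD1 p pp) /= setD1K // addr_eq0 => /eqP E.
have -> : v (s, t) = (-1) ^+ sgn p (t :\ p) * v (s, t).
  have [->|nz] := eqVneq (v (s, t)) 0; first by rewrite mulr0.
  by have := sgnp t nz; rewrite (sgn_D1 p pt) ltnn add0n => ->; rewrite mul1r.
rewrite {}E; congr (- _); apply: eq_big => [j|j jt].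
  by rewrite !inE negb_and negbK; case: eqVneq => [->|]; rewrite ?pt ?andbT.
rewrite wE in_setU1 pt orbT.
have pj : p != j by apply: contraNneq jt => <-.
have -> : (j |: t) :\ p = j |: (t :\ p).
  apply/setP => i; rewrite !inE; case: (eqVneq i p) => [->|] //=.
  by rewrite (negbTE pj).
have [->|nz] := eqVneq (v (s, j |: t :\ p)) 0; first by rewrite oppr0 !mulr0.
have lt_jp : (j < p)%N.
  rewrite ltn_neqAle eq_sym [_ != _]pj p_max //.
  by rewrite (subsetP (vgap _ nz)) // setU11.
by rewrite (sgn_D1 j pt) lt_jp exprD expr1 mulN1r mulNr mulrN opprK.
Qed.

(** Induction on a bound for the weights in the support, in all homological degrees at once. *)
Lemma scalar_exact A v : supp_in A v -> sdiff v = 0 -> saug v = 0 ->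
  exists2 w, supp_in A w & sdiff w = v.
Proof.
have [N] := ubnPleq (\max_(p | v p != 0) weight A p.1).
elim: N v => [|N IHN] v leN suppv dv0 av0.
  (* A nonempty gap would force positive weight, as [p.1] is nonempty and each [i] counts [i.+1]. *)
  have g0 p : v p != 0 -> gap A p.1 = set0.
    move=> nz; have [ps _] := suppv p nz; apply/eqP; apply: contraLR leN => ng.
    rewrite -ltnNge (bigD1 p) //= /weight (negbTE ng) leq_max.
    have /and3P[_ /eqP /symb_setmaxP[x [xs _ _ _]] _] := ps.
    by rewrite (bigD1 x).
  (* All pairs in the support have the same first component and an empty second one, so [saug v] is
     the only coefficient left. *)
  have v0 : v = 0.
    apply/ffunP => p; rewrite ffunE; apply/eqP/negPn/negP => nz.
    have p2 q : v q != 0 -> q.2 = set0.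
      move=> nzq; have [qs qA] := suppv q nzq; apply/eqP.
      rewrite -subset0 -(g0 q nzq); apply: symb_sub_gap qA.
      by rewrite -surjective_pairing.
    case/eqP: (nz); rewrite -[LHS]addr0 -[RHS]av0 /saug.
    rewrite (bigD1 p) ?p2 //= big1 // => q /andP[q20 nqp].
    apply/eqP; apply: contraNT nqp => nzq.
    have [/and3P[_ /eqP cp _] pA] := suppv p nz.
    have [/and3P[_ /eqP cq _] qA] := suppv q nzq.
    rewrite -pair_eqE /= (p2 q) // (p2 p) // eqxx andbT.
    apply/eqP; apply: (gap0_inj cq cp _ _ (g0 q nzq) (g0 p nz)).
      exact: subset_trans (subsetUl _ _) qA.
    exact: subset_trans (subsetUl _ _) pA.
  exists 0; first by move=> p; rewrite ffunE eqxx.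
  by rewrite v0; apply/ffunP => q; rewrite !ffunE big1 // => p _; rewrite ffunE mul0r.
pose h := homotopy A N.+1 v; have supph : supp_in A h by exact: supp_in_homotopy.
have le_wt p : v p != 0 -> (weight A p.1 <= N.+1)%N.
  by move=> nz; apply: leq_trans leN; rewrite (bigD1 p) //= leq_maxl.
(* The differential does not raise weights, so subtracting [sdiff h] clears weight [N.+1] and
   creates nothing above it. *)
have [||||w suppw dw] := IHN (v - sdiff h).
- apply/bigmax_leqP => -[s t] nz; rewrite leqNgt; apply/negP => ltN.
  have [st _] := supp_inB suppv (supp_in_sdiff supph) nz.
  have subE : (v - sdiff h) (s, t) = v (s, t) - sdiff h (s, t) by rewrite !ffunE.
  have wE : weight A s = N.+1.
    apply/eqP; rewrite eqn_leq ltN andbT.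
    move: nz; rewrite subE.
    have [->|/le_wt //] := eqVneq (v (s, t)) 0; rewrite sub0r oppr_eq0.
    case/sdiff_neq0 => p /[dup] nzh /homotopy_neq0[x [_ _ <- _]].
    have [/and3P[_ /eqP cp _] _] := supph p nzh.
    have pg := symb_sub_gap (s := p.1) (t := p.2).
    case/sdiff_elt_neq0 => j jp [_ [[-> _]|[-> _]] //].
    apply/ltnW/weight_shift => //; apply: (subsetP (pg _ _ _)) jp.
      by rewrite -surjective_pairing; case: (supph p nzh).
    by case: (supph p nzh).
  by case/eqP: nz; rewrite subE /h -wE sdiff_homotopy ?wE ?subrr.
- exact: supp_inB (supp_in_sdiff supph).
- by rewrite sdiffB dv0 (sdiff_sdiff supph) subrr.
- by rewrite saugB av0 (saug_sdiff supph) subrr.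
exists (h + w).
  move=> p; rewrite ffunE; have [->|/supph //] := eqVneq (h p) 0.
  by rewrite add0r => /suppw.
have -> : h + w = h - (0 - w) by rewrite sub0r opprK.
have d0 : sdiff 0 = 0.
  by apply/ffunP => q; rewrite !ffunE big1 // => p _; rewrite ffunE mul0r.
by rewrite !sdiffB d0 dw sub0r opprK addrC subrK.
Qed.

End ScalarComplex.

(** * The lcm complex *)

Lemma mlcmA (n : nat) : associative (@mlcm n).
Proof. by move=> u v w; apply/mnmP => i; rewrite !mnmE maxnA. Qed.

HB.instance Definition _ (n : nat) :=
  Monoid.isComLaw.Build 'X_{1..n} 0%MM (@mlcm n)
    (@mlcmA n) (@mlcmC n) (@mlc0m n).

Section LcmSets.

Variables (d r : nat) (m : 'I_r -> 'X_{1..d}).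
Implicit Types (A B : {set 'I_r}).

Lemma mlcm_set_leP A (u : 'X_{1..d}) :
  reflect (forall i, i \in A -> m i <= u)%MM (mlcm_set m A <= u)%MM.
Proof.
apply: (iffP idP) => [le_u i Ai|le_u].
  by move: le_u; rewrite /mlcm_set (bigD1 i) //= lem_mlcm => /andP[].
rewrite /mlcm_set; elim/big_rec: _ => [|i v Ai le_v].
  by apply/mnm_lepP => j; rewrite mnmE.
by rewrite lem_mlcm le_u.
Qed.

Lemma mlcm_setS A B : A \subset B -> (mlcm_set m A <= mlcm_set m B)%MM.
Proof.
move=> /subsetP AB; apply/mlcm_set_leP => i /AB Bi.
exact: (mlcm_set_leP _ _ (lepm_refl _)).
Qed.

End LcmSets.

Lemma mlcm_set_mnm1 (r : nat) (A : {set 'I_r}) (j : 'I_r) :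
  mlcm_set (fun i => U_(i)%MM) A j = (j \in A).
Proof.
apply/eqP; rewrite eqn_leq; apply/andP; split.
  have le : (mlcm_set (fun i => U_(i)) A <= [multinom (i \in A : nat) | i < r])%MM.
    apply/mlcm_set_leP => i Ai; apply/mnm_lepP => l; rewrite mnm1E mnmE.
    by case: eqP => // <-; rewrite Ai.
  by move/mnm_lepP/(_ j): le; rewrite mnmE.
case Aj: (j \in A) => //.
have /mlcm_set_leP/(_ j Aj)/mnm_lepP/(_ j) := lepm_refl (mlcm_set (fun i => U_(i)%MM) A).
by rewrite mnm1E eqxx.
Qed.

(** * Symbols of a fixed homological degree *)

Section Symbols.

Variables (K : fieldType) (r k : nat).
Hypothesis k_gt0 : (0 < k)%N.
Local Notation pair := ({set 'I_r} * {set 'I_r})%type.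

Lemma symb_predE (i : nat) (p : pair) :
  symb_pred k i p = is_symb k p && (#|p.2| == i).
Proof. by rewrite /symb_pred /is_symb -!andbA [(#|p.2| == i) && _]andbC. Qed.

Lemma symb_is_symb i (b : symb r k i) : is_symb k (val b).
Proof. by have := valP b; rewrite symb_predE => /andP[]. Qed.

Lemma card_symb2 i (b : symb r k i) : #|(val b).2| = i.
Proof. by have := valP b; rewrite symb_predE => /andP[_ /eqP]. Qed.

Lemma card_symbU i (b : symb r k i) : #|(val b).1 :|: (val b).2| = (k + i)%N.
Proof.
have /and4P[dis /eqP c1 /eqP c2 _] := valP b.
rewrite -setI_eq0 in dis.
by rewrite cardsU (eqP dis) cards0 subn0 c1 c2.
Qed.

Lemma elt_symb i (b : symb r k i) s t : elt K k s t (val b) = (val b == (s, t))%:R.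
Proof.
rewrite /elt; case: eqP => [<-|]; last by rewrite andbF.
by rewrite symb_is_symb.
Qed.

Lemma sum_symb i (F : pair -> K) :
  (forall p, F p != 0 -> symb_pred k i p) ->
  \sum_p F p = \sum_(b : symb r k i) F (val b).
Proof.
move=> suppF; rewrite (bigID (symb_pred k i)) /= [X in _ + X]big1 => [|p].
  rewrite addr0 (reindex_omap (val : symb r k i -> _) insub) => [|p pP].
    by apply: eq_bigl => b; rewrite valP valK eqxx.
  by case: insubP => [b _ <-|]; rewrite ?pP.
by apply: contraNeq; apply: suppF.
Qed.

(** Extension by zero carries degree [i] into the space where [sdiff] handles all degrees
    together. *)
Definition symb_extend i (x : {ffun symb r k i -> K}) : {ffun pair -> K} :=
  [ffun p => if insub p is Some b then x b else 0].

Lemma symb_extend_val i (x : {ffun symb r k i -> K}) b :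
  symb_extend x (val b) = x b.
Proof. by rewrite ffunE valK. Qed.

Lemma symb_extend_neq0 i (x : {ffun symb r k i -> K}) p :
  symb_extend x p != 0 -> exists2 b, p = val b & x b != 0.
Proof.
by rewrite ffunE; case: insubP => [b _ <- nz|_]; [exists b | rewrite eqxx].
Qed.

Lemma saug_symb_extend (x : {ffun symb r k 0 -> K}) :
  saug (symb_extend x) = \sum_b x b.
Proof.
rewrite /saug big_mkcond (@sum_symb 0) => [|p].
  by apply: eq_bigr => b _; rewrite symb_extend_val -cards_eq0 card_symb2.
case: ifP => [_ /symb_extend_neq0[b -> _]|]; last by rewrite eqxx.
exact: (valP b).
Qed.

Lemma sdiff_elt_symb_pred i (b : symb r k i) p :
  is_symb k p -> sdiff_elt K k p (val b) != 0 -> symb_pred k i.+1 p.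
Proof.
move=> ps /sdiff_elt_neq0[j jp [_ bE]]; rewrite symb_predE ps /=.
have := card_symb2 b; rewrite (cardsD1 j p.2) jp.
by case: bE => -> /= ->.
Qed.

Lemma sdiff_symb_extend i (x : {ffun symb r k i.+1 -> K}) :
  sdiff k (symb_extend x) =
  symb_extend [ffun b' : symb r k i =>
                 \sum_b x b * sdiff_elt K k (val b) (val b')].
Proof.
apply/ffunP => q; rewrite !ffunE (@sum_symb i.+1) => [|p]; last first.
  by rewrite mulf_eq0 negb_or => /andP[/symb_extend_neq0[b -> _] _]; apply: (valP b).
case: insubP => [b' _ <-|nq].
  by rewrite ffunE; apply: eq_bigr => b _; rewrite symb_extend_val.
rewrite big1 // => b _; apply/eqP; rewrite mulf_eq0; apply/orP; right.
apply: contraNT nq => /sdiff_elt_neq0[j jb [qs qE]]; rewrite symb_predE qs /=.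
have := card_symb2 b; rewrite (cardsD1 j) jb => -[<-].
by case: qE => ->.
Qed.

(** The preimage from [scalar_exact] may have components in several degrees; its restriction to
    degree [i.+1] suffices, as only that part maps to degree [i]. *)
Lemma symb_exact A i (x : {ffun symb r k i -> K}) :
  supp_in k A (symb_extend x) ->
  sdiff k (symb_extend x) = 0 -> saug (symb_extend x) = 0 ->
  exists2 y : {ffun symb r k i.+1 -> K},
    forall b, y b != 0 -> (val b).1 :|: (val b).2 \subset A
    & [ffun b' : symb r k i =>
         \sum_b y b * sdiff_elt K k (val b) (val b')] = x.
Proof.
move=> suppx dx ax; have [w suppw dw] := scalar_exact k_gt0 suppx dx ax.
exists [ffun b => w (val b)] => [b|]; first by rewrite ffunE => /suppw[].
apply/ffunP => b'; rewrite -[RHS]symb_extend_val -dw !ffunE (@sum_symb i.+1).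
  by apply: eq_bigr => b _; rewrite ffunE.
move=> p; rewrite mulf_eq0 negb_or => /andP[/suppw[ps _]].
exact: sdiff_elt_symb_pred.
Qed.

End Symbols.

Lemma graded_mdeg (K : fieldType) (n : nat) (C : free_complex {mpoly K[n]})
    (deg : forall i, cbasis C i -> 'X_{1..n}) :
  multigraded deg -> graded (fun i b => mdeg (deg i b)).
Proof.
move=> [deg0 degS]; split=> [b u /deg0 -> //|i b b' u /degS ->].
by rewrite mdegD.
Qed.

(** * The complex over the polynomial ring *)

Section LcmComplex.

Variables (K : fieldType) (d r k : nat) (m : 'I_r -> 'X_{1..d}).
Hypothesis k_gt0 : (0 < k)%N.

Local Notation C := (lcm_complex K m k).
Local Notation deg := (lcm_complex_deg K m k).

Definition symb_coef i (b : cbasis C i.+1) (b' : cbasis C i) : K :=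
  sdiff_elt K k (val b) (val b').
Arguments symb_coef : clear implicits.

(** This reconciles the second case of the differential with the uniform sum: for [j] other than the
    maximum of [t], that maximum stays in [t :\ j] and is too large. *)
Lemma shift_top_notin s t j x :
  @is_symb r k (s, t) -> x \in t -> setmax t = x.+1 -> j \in t -> j != x ->
  (setmax (del_max s) <= setmax t)%N -> is_symb k (shift s j, t :\ j) = false.
Proof.
move=> st xt E jt jx le_st; rewrite (is_symb_shift k_gt0 st) ?subsetDl //.
  have xtj : x \in t :\ j by rewrite !inE eq_sym jx.
  apply/negP; rewrite leq_max; apply/negP; rewrite negb_or -!leqNgt.
  have <- : setmax t = setmax (t :\ j).
    apply/eqP; rewrite eqn_leq [X in _ && X]setmaxS ?subsetDl // andbT.
    by rewrite E setmax_le.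
  by rewrite le_st setmax_le.
by rewrite !inE eqxx.
Qed.

(** Both sides vanish unless [b'] is [(s, t)], and then the quotient of lcms is the monomial of the
    degree difference. *)
Lemma mquo_symb i s t (b : cbasis C i.+1) (b' : cbasis C i) u :
  ((val b).1 :|: (val b).2) :\: u = s :|: t ->
  mquo K m ((val b).1 :|: (val b).2) (((val b).1 :|: (val b).2) :\: u)
    * symb_elt K d k i s t b'
  = elt K k s t (val b') *: 'X_[deg i.+1 b - deg i b'].
Proof.
move=> uE; rewrite elt_symb ffunE uE; case: eqP => [bE|]; last first.
  by rewrite mulr0 scale0r.
by rewrite mulr1 scale1r /mquo /lcm_complex_deg bE.
Qed.

Lemma signZ (e : nat) (a : K) (p : {mpoly K[d]}) :
  ((-1) ^+ e * a) *: p = (-1) ^+ e * (a *: p).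
Proof.
rewrite -scalerA -(signr_odd K) -(signr_odd {mpoly K[d]}).
by case: odd; rewrite ?expr1 ?expr0 ?scaleN1r ?mulN1r ?scale1r ?mul1r.
Qed.

Lemma free_scaleE (R : comNzRingType) (T : finType) a (v : free_module R T) b :
  (a *: v) b = a * v b.
Proof. by rewrite ffunE. Qed.

Lemma free_scaleNE (R : comNzRingType) (T : finType) (a p : R)
    (v : free_module R T) b :
  (a *: - (p *: v)) b = a * - (p * v b).
Proof. by rewrite !ffunE. Qed.

Lemma free_combE (R : comNzRingType) (T : finType) (a p q : R)
    (v w : free_module R T) b :
  (a *: (- (p *: v) + q *: w)) b = a * (- (p * v b) + q * w b).
Proof. by rewrite !ffunE. Qed.

Lemma free_addE (R : comNzRingType) (T : finType) (v w : free_module R T) b :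
  (v + w) b = v b + w b.
Proof. by rewrite ffunE. Qed.

Lemma lcm_diffE i (b : cbasis C i.+1) (b' : cbasis C i) :
  cdiff_basis b b' = symb_coef i b b' *: 'X_[deg i.+1 b - deg i b'].
Proof.
have st := symb_is_symb b; have mq s t u := @mquo_symb i s t b b' u.
rewrite /symb_coef /sdiff_elt scaler_suml /= /lcm_diff.
move: (card_symb2 b) st mq => /=; case: (sval b) => s t /= ct st mq.
have /and3P[/= dst /eqP cs lts] := st.
have [x [xs Ex dE tE]] := symb_setmaxP k_gt0 cs.
have mq1 j : j \in t -> mquo K m (s :|: t) ((s :|: t) :\ j)
    * symb_elt K d k i s (t :\ j) b'
  = elt K k s (t :\ j) (val b') *: 'X_[deg i.+1 b - deg i b'].
  move=> jt; apply: mq; rewrite setDUl; congr (_ :|: _).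
  by apply/setDidPl; rewrite disjoint_sym disjoints1 (disjoint_notin dst).
have mq2 j : j \in t -> mquo K m (s :|: t) ((s :|: t) :\: top s)
    * symb_elt K d k i (j |: del_max s) (t :\ j) b'
  = elt K k (shift s j) (t :\ j) (val b') *: 'X_[deg i.+1 b - deg i b'].
  move=> jt; apply: mq; rewrite setDUl tE -dE.
  have -> : t :\ x = t.
    by apply/setDidPl; rewrite disjoint_sym disjoints1 (disjointFr dst xs).
  by rewrite /shift -{1}(setD1K jt) setUA [_ :|: [set j]]setUC.
case: ltnP => [_|le_st].
  rewrite sum_ffunE; apply: eq_bigr => j jt.
  apply: (etrans (free_combE _ _ _ _ _ _)).
  by rewrite (mq1 _ jt) (mq2 _ jt) signZ scalerBl addrC.
have [y yt Ey] : exists2 y, y \in t & setmax t = y.+1.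
  by apply: setmax_in; rewrite setmax_gt0 -card_gt0 ct.
rewrite (del_maxE yt Ey) (topE yt Ey).
apply: (etrans (free_addE _ _ _)); rewrite sum_ffunE.
set X := 'X_[_]; pose E1 j := elt K k s (t :\ j) (val b').
pose E2 j := elt K k (shift s j) (t :\ j) (val b').
transitivity (\sum_(j in t) (-1) ^+ sgn j t * - (E1 j *: X) + E2 y *: X).
  congr (_ + _); last by apply: (etrans (free_scaleE _ _ _)); rewrite (mq2 _ yt).
  apply: eq_bigr => j jt; apply: (etrans (free_scaleNE _ _ _ _)).
  by rewrite (mq1 _ jt).
(* The shift by the maximum [y] has sign 1 and all other shifts vanish, so the single term is the
   whole sum. *)
have -> : E2 y *: X = \sum_(j in t) (-1) ^+ sgn j t * (E2 j *: X).
  rewrite (bigD1 y) //= big1 => [|j /andP[jt jy]].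
    by rewrite sgn_max ?mul1r ?addr0 // => l /setmax_le; rewrite Ey.
  by rewrite /E2 /elt (shift_top_notin st yt) // scale0r mulr0.
rewrite -big_split; apply: eq_bigr => j jt /=.
by rewrite signZ scalerBl mulrBr addrC mulrN.
Qed.

Lemma symb_coef_subset i b b' : symb_coef i b b' != 0 ->
  (val b').1 :|: (val b').2 \subset (val b).1 :|: (val b).2.
Proof. exact: sdiff_elt_sub. Qed.

Lemma deg_symb_coef i b b' : symb_coef i b b' != 0 -> (deg i b' <= deg i.+1 b)%MM.
Proof. by move=> /symb_coef_subset; apply: mlcm_setS. Qed.

Lemma lcm_augE (b : cbasis C 0) : caug_basis b = 'X_[deg 0 b].
Proof.
have := card_symb2 b => /eqP; rewrite cards_eq0 => /eqP b0.
by rewrite /lcm_complex_deg b0 setU0.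
Qed.

Lemma multigraded_lcm_complex : multigraded deg.
Proof. exact: multigraded_monomial_entries lcm_augE lcm_diffE deg_symb_coef. Qed.

Lemma lcm_augP f : lcm_ideal K m k f <-> exists v, caug (C := C) v = f.
Proof.
(* As [k > 0], every [k]-subset has a maximum above that of the empty set. *)
have symb0P (s : {set 'I_r}) : symb_pred k 0 (s, set0) = (#|s| == k).
  rewrite symb_predE /is_symb /= cards0 eqxx andbT setmax0 setmax_gt0.
  rewrite -card_gt0 -setI_eq0 setI0 eqxx /=.
  by case: eqP => //= ->.
have sumE (g : {set 'I_r} -> {mpoly K[d]}) :
    \sum_(b : cbasis C 0) g (val b).1 = \sum_(s : {set 'I_r} | #|s| == k) g s.
  rewrite [RHS](reindex_omap (fun b : symb r k 0 => (val b).1)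
    (fun s => insub (s, set0))) => [|s sk].
    apply: eq_bigl => b; have /and4P[_ -> b2 _] := valP b.
    rewrite cards_eq0 in b2; rewrite -(eqP b2) -surjective_pairing valK.
    by rewrite eqxx.
  by rewrite insubT ?symb0P.
split=> [[c ->]|[v <-]].
  by exists [ffun b => c (val b).1]; rewrite -sumE; apply: eq_bigr => b _; rewrite ffunE.
exists (fun s => if insub (s, set0) is Some b then v b else 0).
rewrite -sumE; apply: eq_bigr => b _; congr (_ * _).
have /and4P[_ _ b2 _] := valP b; rewrite cards_eq0 in b2.
by rewrite -(eqP b2) -surjective_pairing valK.
Qed.

Lemma supp_in_symb_extend i u (x : {ffun symb r k i -> K}) :
  strand_supp (deg i) u x ->
  supp_in k [set j | (m j <= u)%MM] (symb_extend x).
Proof.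
move=> supp_x p /symb_extend_neq0[b -> /supp_x le_u].
split; first exact: symb_is_symb.
by apply/subsetP => j jb; rewrite inE; apply: (mlcm_set_leP _ _ _ le_u).
Qed.

Lemma lcm_complex_resolution : free_resolution C (lcm_ideal K m k).
Proof.
have suppT i (x : {ffun symb r k i -> K}) : supp_in k setT (symb_extend x).
  move=> p /symb_extend_neq0[b -> _]; split; first exact: symb_is_symb.
  exact: subsetT.
(* One of the two vanishing conditions is automatic: that on [sdiff] in degree 0, that on [saug] in
   positive degree. *)
have exact_strand i u (x : {ffun symb r k i -> K}) : strand_supp (deg i) u x ->
    sdiff k (symb_extend x) = 0 -> saug (symb_extend x) = 0 ->
    exists2 y, strand_supp (deg i.+1) u y & scalar_diff symb_coef y = x.
  move=> /supp_in_symb_extend suppx dx ax.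
  have [y supp_y dy] := symb_exact k_gt0 suppx dx ax.
  exists y => // b /supp_y /subsetP bA; apply/mlcm_set_leP => j /bA.
  by rewrite inE.
apply: (free_resolution_strands lcm_augE lcm_diffE deg_symb_coef).
- exact: lcm_augP.
- move=> x; rewrite -saug_symb_extend -sdiff_symb_extend.
  by rewrite (saug_sdiff k_gt0 (suppT _ x)).
- move=> i x; apply/ffunP => b; rewrite [RHS]ffunE -symb_extend_val.
  by rewrite -2!sdiff_symb_extend (sdiff_sdiff k_gt0 (suppT _ x)) ffunE.
- move=> u x supp_x x0; apply: exact_strand => //; last by rewrite saug_symb_extend.
  apply/ffunP => q; rewrite !ffunE big1 // => p _.
  have [->|/symb_extend_neq0[b -> _]] := eqVneq (symb_extend x p) 0.
    by rewrite mul0r.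
  rewrite /sdiff_elt big_pred0 ?mulr0 // => j.
  by have /eqP := card_symb2 b; rewrite cards_eq0 => /eqP ->; rewrite inE.
- move=> i u x supp_x dx; apply: exact_strand => //.
    rewrite sdiff_symb_extend -[X in symb_extend X]/(scalar_diff symb_coef x).
    by rewrite dx; apply/ffunP => q; rewrite !ffunE; case: insub => // b; rewrite ffunE.
  rewrite /saug big1 // => q /eqP q0; apply/eqP/negPn/negP.
  case/symb_extend_neq0 => b qE _.
  by have := card_symb2 b; rewrite -qE q0 cards0.
Qed.

End LcmComplex.

(** * The k-out-of-r ideal and Betti numbers *)

Lemma free_resolution_eq (R : comNzRingType) (C : free_complex R)
    (I J : R -> Prop) :
  (forall f, I f <-> J f) -> free_resolution C I -> free_resolution C J.
Proof.
move=> IJ [aug ex0 ex]; split=> // f.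
by split=> [/IJ/aug // | /aug/IJ].
Qed.

Lemma k_out_of_r_lcm_ideal (K : fieldType) (r k : nat) (f : {mpoly K[r]}) :
  lcm_ideal K (fun i : 'I_r => U_(i)%MM) k f <-> k_out_of_r_ideal K r k f.
Proof.
have gE (s : {set 'I_r}) :
    'X_[K, mlcm_set (fun i : 'I_r => U_(i)%MM) s] = \prod_(i in s) 'X_i.
  rewrite mprodXE; congr 'X_[_]; apply/mnmP => j.
  rewrite mlcm_set_mnm1 mnm_sumE; case: (boolP (j \in s)) => js.
    rewrite (bigD1 j) //= mnm1E eqxx big1 // => i /andP[_ /negbTE ij].
    by rewrite mnm1E ij.
  rewrite big1 // => i i_s; rewrite mnm1E; case: eqP => // ij.
  by rewrite -ij i_s in js.
by split=> -[c ->]; exists c; apply: eq_bigr => s _; rewrite gE.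
Qed.

(** For variables the lcm determines its index set, and the union of the two sets loses an element
    under the differential, so degrees differ. *)
Lemma minimal_k_out_of_r (K : fieldType) (r k : nat) : (0 < k)%N ->
  minimal (lcm_complex K (fun i : 'I_r => U_(i)%MM) k).
Proof.
move=> k_gt0; set m := fun i : 'I_r => U_(i)%MM.
apply: (minimal_monomial_entries (@lcm_diffE K r r k m k_gt0)
          (@deg_symb_coef K r r k m)).
move=> i b b' _; apply/eqP => degE.
have /setP/eq_card : (val b').1 :|: (val b').2 = (val b).1 :|: (val b).2.
  apply/setP => j; have := congr1 (fun u : 'X_{1..r} => u j) degE.
  by rewrite /lcm_complex_deg /= !mlcm_set_mnm1 => /eqP; do 2!case: (j \in _).
by rewrite !card_symbU => /eqP; rewrite eqn_add2l; apply/negP; rewrite ltn_eqF.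
Qed.

Lemma minimal_resolution_card_le (K : fieldType) (n : nat)
    (J : {mpoly K[n]} -> Prop) (C D : free_complex {mpoly K[n]}) (i : nat) :
  free_resolution C J -> minimal C -> free_resolution D J ->
  (#|cbasis C i| <= #|cbasis D i|)%N.
Proof.
move=> resC minC resD.
exact: (@minimal_basis_card_le _ K (mcoeff 0%MM) J C D resC resD minC i).
Qed.

Lemma betti_le (K : fieldType) (n : nat) (J : {mpoly K[n]} -> Prop)
    (D : free_complex {mpoly K[n]}) (i : nat) :
  free_resolution D J -> (betti J i <= #|cbasis D i|)%N.
Proof.
move=> resD; rewrite /betti; case: excluded_middle_informative => [e|//].
case: constructive_indefinite_description => b /= [C [_ [resC _ minC <-]]].
exact: minimal_resolution_card_le resD.
Qed.

(** [C] shows that a Betti number exists; whichever resolution [betti] picks has at least the ranks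
    of the minimal [C]. *)
Lemma betti_ge (K : fieldType) (n : nat) (J : {mpoly K[n]} -> Prop)
    (C : free_complex {mpoly K[n]}) (deg : forall i, cbasis C i -> nat) i :
  free_resolution C J -> graded deg -> minimal C ->
  (#|cbasis C i| <= betti J i)%N.
Proof.
move=> resC degC minC; rewrite /betti.
case: excluded_middle_informative => [e|[]]; last first.
  by exists #|cbasis C i|, C, deg.
case: constructive_indefinite_description => b /= [D [_ [resD _ _ <-]]].
exact: minimal_resolution_card_le resD.
Qed.

Theorem theorem3p3 (K : fieldType) (d r : nat) (m : 'I_r -> 'X_{1..d})
    (hmin : minimal_generators K m) (k : nat) (hk : (1 <= k <= r)%N) :
  [/\ multigraded (lcm_complex_deg K m k),
      free_resolution (lcm_complex K m k) (lcm_ideal K m k)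
    & forall i : nat,
        (betti (lcm_ideal K m k) i <= betti (k_out_of_r_ideal K r k) i)%N].
Proof.
have k_gt0 : (0 < k)%N by case/andP: hk.
split=> [||i]; [exact: multigraded_lcm_complex | exact: lcm_complex_resolution |].
(* The bases depend on [r] and [k] only, so the complexes for [m] and for the variables have equal
   ranks, which lie between the two Betti numbers. *)
apply: (leq_trans (betti_le i (@lcm_complex_resolution K d r k m k_gt0))).
pose U (j : 'I_r) : 'X_{1..r} := U_(j)%MM.
apply: (@betti_ge K r _ (lcm_complex K U k)
          (fun i b => mdeg (lcm_complex_deg K U k i b))).
- apply: free_resolution_eq (@lcm_complex_resolution K r r k U k_gt0).
  exact: k_out_of_r_lcm_ideal.
- exact/graded_mdeg/multigraded_lcm_complex.
- exact: minimal_k_out_of_r.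
Qed.
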